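(* Let $\epsilon < \frac{1}{23}$ be a real number. Let $G$ be a finite bipartite graph with bipartition $(L,R)$ such that each vertex in $L$ has degree at most $3$ and no two distinct degree-$3$ vertices of $L$ have the same set of neighbours. Suppose $|N_G(L)| \geq (2-\epsilon)|L|$ and that for every proper subset $L' \subsetneq L$ there is a $(2,4)$-matching in $G$ covering $L'$. Then there is a $(2,4)$-matching in $G$ covering $L$.
   Context: For a bipartite graph $G$ with bipartition $(L,R)$, a $(2,4)$-matching in $G$ is a subgraph $F$ of $G$ such that (1) each connected component of $F$ is a tree with at most $4$ edges, and (2) each vertex in $V(F)\cap L$ has degree exactly $2$ in $F$. A $(2,4)$-matching $F$ covers a set of vertices $S$ if $S \subseteq V(F)$. $N_G(A)$ denotes the set of neighbours in $G$ of vertices of $A$. *)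

(* Defs.v *)
From mathcomp Require Import all_boot.

Set Implicit Arguments.
Unset Strict Implicit.
Unset Printing Implicit Defensive.

(** Finite simple graphs whose vertices are drawn from a finite type [T].  The
    vertex set is part of the data, so that a graph and its subgraphs have the
    same Rocq type, and a subgraph may have isolated vertices. *)
Record graph (T : finType) := Graph {
  vset : {set T};
  adj : rel T;
  adj_sym : symmetric adj;
  adj_irrefl : irreflexive adj;
  adj_vset : forall x y, adj x y -> x \in vset
}.

Section GraphDefs.
Variable T : finType.
Implicit Types (G F H : graph T) (A L R S : {set T}) (x y : T).

Definition subgraph F G : Prop :=
  vset F \subset vset G /\ subrel (adj F) (adj G).

Definition nbrs G x : {set T} := [set y | adj G x y].

Definition nbrs_of G A : {set T} := \bigcup_(x in A) nbrs G x.

Definition degree G x : nat := #|nbrs G x|.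

Definition edges G : {set {set T}} :=
  [set [set p.1; p.2] | p : T * T & adj G p.1 p.2].

Definition is_connected G : Prop :=
  vset G != set0 /\ {in vset G &, forall x y, connect (adj G) x y}.

Definition acyclic G : Prop :=
  forall c : seq T, 2 < size c -> uniq c -> ~~ cycle (adj G) c.

Definition is_tree G : Prop := is_connected G /\ acyclic G.

Definition induced_adj G A : rel T :=
  fun x y => [&& x \in A, y \in A & adj G x y].

Lemma induced_sym G A : symmetric (induced_adj G A).
Proof. by move=> x y; rewrite /induced_adj adj_sym andbCA. Qed.

Lemma induced_irrefl G A : irreflexive (induced_adj G A).
Proof. by move=> x; rewrite /induced_adj adj_irrefl !andbF. Qed.

Lemma induced_vset G A x y : induced_adj G A x y -> x \in vset G :&: A.
Proof. by case/and3P=> xA _ /adj_vset xG; rewrite inE xG xA. Qed.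

Definition induced G A : graph T :=
  @Graph T (vset G :&: A) (induced_adj G A)
    (@induced_sym G A) (@induced_irrefl G A) (@induced_vset G A).

(** The connected component of [G] containing [x], for [x \in vset G]. *)
Definition component G x : graph T := induced G [set y | connect (adj G) x y].

Definition bipartition G L R : Prop :=
  [/\ L :|: R = vset G, [disjoint L & R] &
      forall x y, adj G x y -> (x \in L) && (y \in R) || (x \in R) && (y \in L)].

(** (2,4)-matchings; [L] is the first side of the bipartition of [G]. *)
Definition matching24 G L F : Prop :=
  [/\ subgraph F G,
      forall x, x \in vset F ->
        is_tree (component F x) /\ #|edges (component F x)| <= 4 &
      forall x, x \in vset F :&: L -> degree F x = 2].

Definition covers F S : Prop := S \subset vset F.

End GraphDefs.

(* Main.v *)
(** Call a neighbour of [x \in L] private when [x] is its only neighbour.  If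
    some [x] has two private neighbours, or if some [r] has exactly two
    neighbours [x], [y] and both have a private neighbour, then the path
    [p x q], resp. [p x r y q], has all neighbours of its [R]-vertices on itself;
    so it can be added to a (2,4)-matching covering the other vertices of [L]
    once that matching is cut away from the path.
    Otherwise a discharging argument gives [5 |N(L)| <= 9 |L|], which contradicts
    [|N(L)| >= (2 - eps) |L|] as soon as [eps < 1/5]. *)
Require Import Defs.
From mathcomp Require Import all_boot all_order all_algebra.
From mathcomp Require Import reals.
From mathcomp Require Import zify lra.
Import Order.TTheory GRing.Theory Num.Theory.

Section Graphs.
Set Implicit Arguments.
Unset Strict Implicit.
Variable T : finType.
Implicit Types (G F H : graph T) (A L R S : {set T}) (x y : T) (s : seq T).

(** * Subgraphs, connectivity and acyclicity *)

Lemma acyclic_subrel G H : subrel (adj G) (adj H) -> acyclic H -> acyclic G.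
Proof.
by move=> sGH acH c c2 Uc; apply: contra (acH c c2 Uc); apply: sub_cycle.
Qed.

Lemma edges_subrel G H : subrel (adj G) (adj H) -> edges G \subset edges H.
Proof.
move=> sGH; apply/subsetP=> e /imsetP[p Gp ->]; apply/imsetP; exists p => //.
by move: Gp; rewrite !inE; apply: sGH.
Qed.

(** A walk of [e] that starts in [A] can never leave [A], so each of its steps is also a step of
    [e']. *)
Lemma connect_mono_closed (e e' : rel T) A :
    {in A, forall x y, e x y -> e' x y && (y \in A)} ->
  {in A, forall x y, connect e x y -> connect e' x y && (y \in A)}.
Proof.
move=> ee' x ax y /connectP[p]; elim: p x ax => [|z p IHp] x ax /=.
  by move=> _ ->; rewrite connect0.
case/andP=> /(ee' x ax)/andP[e'xz az] zp lp.
by have /andP[/(connect_trans (connect1 e'xz))-> ->] := IHp z az zp lp.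
Qed.

Lemma connected_component G x : x \in vset G -> is_connected (component G x).
Proof.
move=> Gx; set A := [set y | connect (adj G) x y].
have symi : connect_sym (induced_adj G A).
  by apply: sym_connect_sym; apply: induced_sym.
have AGA : {in A, forall u v, adj G u v -> induced_adj G A u v && (v \in A)}.
  move=> u Au v Guv; have Av : v \in A.
    by move: Au; rewrite !inE => /connect_trans; apply; apply: connect1.
  by rewrite /induced_adj Au Av Guv.
have Ax y : y \in A -> connect (induced_adj G A) x y.
  rewrite inE => Gxy.
  have /(connect_mono_closed AGA)/(_ _ Gxy)/andP[] // : x \in A.
  by rewrite inE connect0.
split; first by apply/set0Pn; exists x; rewrite !inE Gx connect0.
move=> y z /setIP[_ Ay] /setIP[_ Az].
by apply: connect_trans (Ax z Az); rewrite symi; apply: Ax.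
Qed.

(* A vertex of minimal rank on a cycle would have two distinct cycle
   neighbours of at least its rank. *)
Lemma acyclic_rank G (f : T -> nat) :
    (forall x y z, adj G x y -> adj G x z -> f x <= f y -> f x <= f z -> y = z) ->
  acyclic G.
Proof.
move=> fP c c2 Uc; apply/negP=> Cc.
have [x0 cx0] : exists x0, x0 \in c.
  by case: c c2 {Uc Cc} => // a c _; exists a; rewrite mem_head.
have [m cm minm] : exists2 m, m \in c & {in c, forall y, f m <= f y}.
  by case: (arg_minnP f cx0) => m cm minm; exists m.
have [i c' Ec] := rot_to cm.
rewrite -(rot_cycle i) -(rot_uniq i) -(size_rot i) Ec in Cc Uc c2 *.
have mc' : {in c', forall y, f m <= f y}.
  by move=> y c'y; apply: minm; rewrite -(mem_rot i) Ec inE c'y orbT.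
(* The rotated cycle reads [m, a, ..., b]; its length exceeds 2, so the two cycle neighbours [a] and
   [b] of [m] are distinct. *)
case: c' {Ec} c2 mc' Cc Uc => [|a c'] //; case/lastP: c' => // c' b _ mc' /=.
rewrite !rcons_path last_rcons => /and3P[Gma _ Gbm].
rewrite adj_sym in Gbm.
rewrite mem_rcons [a \in _]inE => /and3P[_ /norP[/eqP ab _] _]; apply: ab.
apply: fP Gma Gbm _ _; apply: mc'; first exact: mem_head.
by rewrite inE mem_rcons mem_head orbT.
Qed.

(** * Paths given by vertex sequences *)

(** Comparing positions makes the relation symmetric and irreflexive for every [s], with no
    assumption that [s] is duplicate-free. *)
Definition path_adj s : rel T := fun x y =>
  [&& x \in s, y \in s &
   ((index x s).+1 == index y s) || ((index y s).+1 == index x s)].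

Lemma path_adj_sym s : symmetric (path_adj s).
Proof. by move=> x y; rewrite /path_adj andbCA orbC. Qed.

Lemma path_adj_irrefl s : irreflexive (path_adj s).
Proof. by move=> x; rewrite /path_adj; lia. Qed.

Lemma path_adj_mem s x y : path_adj s x y -> x \in [set z in s].
Proof. by rewrite inE => /andP[]. Qed.

Definition path_graph s : graph T :=
  Graph (@path_adj_sym s) (@path_adj_irrefl s) (@path_adj_mem s).

(** With position as rank, only the successor of a vertex is a neighbour of at least its rank. *)
Lemma acyclic_path_graph s : acyclic (path_graph s).
Proof.
apply: (@acyclic_rank _ (index^~ s)) => x y z /and3P[sx sy xy] /and3P[_ sz xz].
move=> lexy lexz; have E : index y s = index z s by lia.
by rewrite -(nth_index x sy) E nth_index.
Qed.

Lemma card_edges_path_graph s : #|edges (path_graph s)| <= (size s).-1.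
Proof.
case: s => [|a s].
  rewrite leqn0 cards_eq0; apply/eqP/setP=> e; rewrite in_set0.
  by apply/idP=> /imsetP[p]; rewrite inE.
(* An edge is indexed by the smaller position of its two ends; here [s] is the tail, so [size s]
   counts all positions but the last. *)
pose f (i : 'I_(size s)) := [set nth a (a :: s) i; nth a (a :: s) i.+1].
rewrite /= -[X in _ <= X]card_ord; apply: leq_trans (leq_imset_card f _).
apply/subset_leq_card/subsetP=> e /imsetP[[x y]].
rewrite inE /= => /and3P[sx sy xy] ->.
wlog xy' : x y sx sy {xy} / (index x (a :: s)).+1 = index y (a :: s).
  by move=> W; case/orP: xy => /eqP /W; [|rewrite setUC]; apply.
have lti : index x (a :: s) < size s by rewrite -ltnS xy' index_mem.
by apply/imsetP; exists (Ordinal lti) => //; rewrite /f [val _]/= xy' !nth_index.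
Qed.

Lemma degree_path_graph s x : uniq s -> x \in s -> 0 < index x s ->
  (index x s).+1 < size s -> degree (path_graph s) x = 2.
Proof.
rewrite /degree => Us sx; move Ei: (index x s) => i i0 ilt.
have jlt : i.-1 < size s by lia.
have -> : nbrs (path_graph s) x = [set nth x s i.-1; nth x s i.+1].
  apply/setP=> y; rewrite !inE /= /path_adj sx Ei /=.
  apply/andP/orP=> [[sy /orP[]/eqP E]|[]/eqP->].
  - by right; rewrite E nth_index.
  - by left; rewrite -E nth_index.
  - by rewrite mem_nth ?index_uniq // prednK ?eqxx ?orbT.
  - by rewrite mem_nth ?index_uniq // eqxx.
by rewrite cards2 nth_uniq // neq_ltn ltnS leq_pred.
Qed.

(** * Inserting a path into a matching *)

Lemma component_subrel G x : subrel (adj (component G x)) (adj G).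
Proof. by move=> y z /and3P[]. Qed.

Lemma component_mono_closed G H A :
    {in A, forall x y, adj G x y -> adj H x y && (y \in A)} ->
  {in A, forall x, subrel (adj (component G x)) (adj (component H x))}.
Proof.
move=> AGH x Ax y z /and3P[]; rewrite !inE.
move=> /(connect_mono_closed AGH Ax)/andP[Hxy Ay].
move=> /(connect_mono_closed AGH Ax)/andP[Hxz _] /(AGH y Ay)/andP[Hyz _].
by rewrite /= /induced_adj !inE Hxy Hxz.
Qed.

Lemma bipartition_adj G L R x y :
  bipartition G L R -> adj G x y -> (y \in L) = (x \notin L).
Proof.
move=> [_ dLR bipG] /bipG/orP[]/andP[]; first by move=> -> /(disjointFl dLR)->.
by move=> /(disjointFl dLR)-> ->.
Qed.

(** All edges of [F] meeting [s] are deleted and the path is put in their place. Components off [s]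
    can only shrink, and those meeting [s] lie on a path with at most 4 edges. A vertex of [L] off
    [s] loses no edge, because the vertices of [s] outside [L] have all their neighbours on [s]. *)
Lemma matching24_add_path G L R F s :
    bipartition G L R -> matching24 G L F ->
    uniq s -> odd (size s) -> size s <= 5 -> subgraph (path_graph s) G ->
    {in s, forall z, (z \in L) = odd (index z s)} ->
    {in s, forall z, z \notin L -> nbrs G z \subset s} ->
  exists2 F', matching24 G L F' & vset F' = vset F :|: [set z in s].
Proof.
move=> bipG [[sVFG sFG] compF degF] Us odd_s s5 [sVsG ssG] sL sR.
pose e x y := [&& x \notin s, y \notin s & adj F x y] || path_adj s x y.
have e_sym : symmetric e.
  by move=> x y; rewrite /e path_adj_sym adj_sym andbCA.
have e_irr : irreflexive e.
  by move=> x; rewrite /e adj_irrefl path_adj_irrefl !andbF.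
have e_vset x y : e x y -> x \in vset F :|: [set z in s].
  rewrite in_setU; case/orP=> [/and3P[_ _ /adj_vset->] // | /path_adj_mem->].
  by rewrite orbT.
pose F' := Graph e_sym e_irr e_vset.
have outF' : {in ~: [set z in s], forall x y,
    adj F' x y -> adj F x y && (y \in ~: [set z in s])}.
  move=> x; rewrite !inE => s'x y; rewrite !inE.
  by case/orP=> [/and3P[_ -> ->]//|/and3P[sx]]; rewrite sx in s'x.
have inF' : {in [set z in s], forall x y,
    adj F' x y -> adj (path_graph s) x y && (y \in [set z in s])}.
  move=> x; rewrite !inE => sx y; rewrite !inE.
  case/orP=> [/and3P[]|sxy]; first by rewrite sx.
  by apply/andP; split=> //; case/and3P: sxy.
exists F' => //; split.
- split; first by rewrite subUset sVFG.
  by move=> x y /orP[/and3P[_ _]|]; [apply: sFG|apply: ssG].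
- move=> x F'x; have [sx|s'x] := boolP (x \in s).
    have sub : subrel (adj (component F' x)) (adj (path_graph s)).
      move=> y z /(component_mono_closed inF'); rewrite inE => /(_ sx).
      exact: component_subrel.
    split; first split.
    + exact: connected_component.
    + exact: acyclic_subrel sub (acyclic_path_graph s).
    + apply: leq_trans (subset_leq_card (edges_subrel sub)) _.
      by apply: leq_trans (card_edges_path_graph s) _; lia.
  have Fx : x \in vset F by move: F'x; rewrite !inE (negPf s'x) orbF.
  have [[_ acF] F4] := compF x Fx.
  have sub : subrel (adj (component F' x)) (adj (component F x)).
    by apply: component_mono_closed outF' _ _; rewrite !inE.
  split; first split.
  + exact: connected_component.
  + exact: acyclic_subrel sub acF.
  + by apply: leq_trans F4; apply/subset_leq_card/edges_subrel.
- move=> x /setIP[F'x Lx]; have [sx|s'x] := boolP (x \in s).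
    (* An odd position is not the first one, nor the last one of a sequence of odd length, so [x] is
       an inner vertex of the path. *)
    have oddx : odd (index x s) by rewrite -sL.
    have ltx : index x s < size s by rewrite index_mem.
    rewrite -(@degree_path_graph s x) //; [|lia|].
      apply: eq_card => y; rewrite !inE.
      apply/idP/idP=> [xy|]; last by rewrite /= /e => ->; rewrite orbT.
      by have := inF' x; rewrite inE => /(_ sx y xy) /andP[].
    have : (index x s).+1 <> size s by move=> E; move: odd_s; rewrite -E /= oddx.
    lia.
  have Fx : x \in vset F by move: F'x; rewrite !inE (negPf s'x) orbF.
  rewrite -(degF x); last by rewrite inE Fx.
  apply: eq_card => y; rewrite !inE /= /e s'x /= /path_adj (negPf s'x) orbF.
  apply/andP/idP=> [[]//|Fxy]; split=> //; apply/negP=> sy.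
  have Gxy := sFG _ _ Fxy.
  have L'y : y \notin L by rewrite (bipartition_adj bipG Gxy) Lx.
  have /subsetP/(_ x) := sR y sy L'y.
  by rewrite inE adj_sym (negPf s'x) => /(_ Gxy).
Qed.

Lemma subgraph_path_graph G s :
  sorted (adj G) s -> {subset s <= vset G} -> subgraph (path_graph s) G.
Proof.
move=> Gs sG; split; first by apply/subsetP=> x; rewrite inE; apply: sG.
move=> x y /and3P[sx sy].
wlog xy : x y sx sy / (index x s).+1 = index y s => [W|_].
  by case/orP=> /eqP E; [|rewrite adj_sym]; apply: W => //; rewrite E eqxx.
have := (sortedP x Gs) (index x s).
by rewrite xy index_mem sy !nth_index //; apply.
Qed.

(** Since [s] meets [L], the set [L] minus [s] is a proper subset and has a covering matching;
    inserting the path then covers the rest of [L]. *)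
Lemma matching24_cover_path G L R s :
    bipartition G L R ->
    (forall L', L' \proper L -> exists F, matching24 G L F /\ covers F L') ->
    uniq s -> odd (size s) -> size s <= 5 -> sorted (adj G) s ->
    {subset s <= vset G} -> has (mem L) s ->
    {in s, forall z, (z \in L) = odd (index z s)} ->
    {in s, forall z, z \notin L -> nbrs G z \subset s} ->
  exists F, matching24 G L F /\ covers F L.
Proof.
move=> bipG minL Us odd_s s5 Gs sG /hasP[x sx Lx] sL sR.
have [|F [mF cF]] := minL (L :\: [set z in s]).
  apply/properP; split; first exact: subsetDl.
  by exists x; rewrite // !inE sx.
have [F' mF' vF'] :=
  matching24_add_path bipG mF Us odd_s s5 (subgraph_path_graph Gs sG) sL sR.
by exists F'; split=> //; rewrite /covers vF' setUC -subDset.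
Qed.

(** * Private neighbours and discharging *)

Definition priv G x : {set T} := [set r in nbrs G x | degree G r == 1].

Lemma nbrs_priv G x r : r \in priv G x -> nbrs G r = [set x].
Proof.
rewrite !inE => /andP[Gxr /cards1P[y Ey]].
have : x \in nbrs G r by rewrite inE adj_sym.
by rewrite Ey inE => /eqP->.
Qed.

(** Double counting of the edges at [L]: by bipartiteness, every neighbour of a vertex of N(L) is
    back in [L]. *)
Lemma sum_nbrs_of (w : T -> T -> nat) G L R : bipartition G L R ->
  \sum_(r in nbrs_of G L) \sum_(x in nbrs G r) w x r =
  \sum_(x in L) \sum_(r in nbrs G x) w x r.
Proof.
move=> bipG; rewrite (exchange_big_dep (mem L)) /=; last first.
  move=> r x /bigcupP[y Ly]; rewrite !inE => Gyr Grx.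
  by rewrite (bipartition_adj bipG Grx) (bipartition_adj bipG Gyr) Ly.
apply: eq_bigr => x Lx; apply: eq_bigl => r; rewrite !inE adj_sym andb_idl //.
by move=> Gxr; apply/bigcupP; exists x; rewrite // inE.
Qed.

(* Each [r] in [N(L)] receives at least 5 units from its neighbours and each
   [x] in [L] gives at most 9: it gives 5 to a private neighbour, and to the
   other ones 2 if it has a private neighbour, 3 otherwise. *)
Lemma card_nbrs_of_le G L R :
    bipartition G L R -> {in L, forall x, degree G x <= 3} ->
    {in L, forall x, #|priv G x| <= 1} ->
    {in nbrs_of G L, forall r, degree G r = 2 ->
       exists2 x, x \in nbrs G r & priv G x = set0} ->
  5 * #|nbrs_of G L| <= 9 * #|L|.
Proof.
move=> bipG deg3 priv1 deg2.
pose w x r := if degree G r == 1 then 5 else if priv G x == set0 then 3 else 2.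
rewrite -![_ * #|_|]mulnC -!sum_nat_const.
apply: leq_trans (_ : \sum_(r in nbrs_of G L) \sum_(x in nbrs G r) w x r <= _).
  apply: leq_sum => r Nr.
  have deg_gt0 : 0 < degree G r.
    case/bigcupP: Nr => x _; rewrite inE => Gxr.
    by apply/card_gt0P; exists x; rewrite inE adj_sym.
  (* Received amounts: 5 in degree 1; at least 3 + 2 in degree 2, where some neighbour has no
     private neighbour; at least 3 * 2 in higher degree. *)
  have [r1|r_n1] := eqVneq (degree G r) 1.
    rewrite (eq_bigr (fun=> 5)) => [|x _]; last by rewrite /w r1.
    by rewrite sum_nat_const [#|_|]r1.
  have w2 x : 2 <= w x r by rewrite /w (negPf r_n1); case: ifP.
  have [r2|r_n2] := eqVneq (degree G r) 2.
    have [x rx x0] := deg2 r Nr r2; rewrite (bigD1 x) //= {1}/w (negPf r_n1) x0 eqxx.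
    have : #|nbrs G r :\ x| = 1.
      by have := cardsD1 x (nbrs G r); rewrite rx [#|_|]r2; lia.
    move=> /eqP/cards1P[y Ey]; rewrite (bigD1 y) /=; first by have := w2 y; lia.
    by rewrite andbC -in_setD1 Ey inE.
  apply: leq_trans (_ : \sum_(x in nbrs G r) 2 <= _); last exact: leq_sum.
  by rewrite sum_nat_const -/(degree G r); lia.
rewrite (sum_nbrs_of w bipG); apply: leq_sum => x Lx.
have /setIidPr privx : priv G x \subset nbrs G x.
  by apply/subsetP=> r; rewrite inE => /andP[].
rewrite (big_setID (priv G x)) /= privx.
rewrite (eq_bigr (fun=> 5)) => [|r]; last first.
  by case/setIdP=> _ r1; rewrite /w r1.
rewrite [X in _ + X](eq_bigr (fun=> if priv G x == set0 then 3 else 2)); last first.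
  by move=> r /setDP[Gxr]; rewrite inE Gxr /w /= => /negPf->.
rewrite !sum_nat_const -cards_eq0.
(* Given amounts: at most 5 + 2 * 2 with one private neighbour, and at most 3 * 3 with none. *)
have := deg3 x Lx; rewrite /degree -(cardsID (priv G x)) privx.
by have := priv1 x Lx; case: eqP; lia.
Qed.

Lemma matching24_cover_or_card_le G L R :
    bipartition G L R -> {in L, forall x, degree G x <= 3} ->
    (forall L', L' \proper L -> exists F, matching24 G L F /\ covers F L') ->
  (exists F, matching24 G L F /\ covers F L) \/ 5 * #|nbrs_of G L| <= 9 * #|L|.
Proof.
move=> bipG deg3 minL; have adjL := bipartition_adj bipG.
(* Both orientations are kept as rewrite rules, to evaluate [uniq] and [index] on the explicit paths
   below. *)
have neqL u v : u \in L -> v \notin L -> (u == v = false) * (v == u = false).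
  move=> Lu L'v; have uv : u != v by apply: contraNneq L'v => <-.
  by rewrite [v == u]eq_sym (negPf uv).
(* First case: two private neighbours [p], [q] of one [x] give the path [p x q]. *)
have [/existsP[x /andP[Lx /card_gt1P[p [q [xp xq pq]]]]]|priv1] :=
    boolP [exists x, (x \in L) && (1 < #|priv G x|)].
  left; have [Ep Eq] := (nbrs_priv xp, nbrs_priv xq).
  have [Gxp Gxq] : adj G x p /\ adj G x q.
    by move: xp xq; rewrite !inE => /andP[-> _] /andP[-> _].
  have L'p : p \notin L by rewrite (adjL x) // Lx.
  have L'q : q \notin L by rewrite (adjL x) // Lx.
  pose neq := (neqL x p Lx L'p, neqL x q Lx L'q, negPf pq).
  pose inL := (Lx, negPf L'p, negPf L'q).
  apply: (@matching24_cover_path G L R [:: p; x; q]) => //.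
  - by rewrite /= !inE !neq.
  - by rewrite /= adj_sym Gxp Gxq.
  - apply/allP; rewrite /= (adj_vset Gxp).
    by move: Gxp Gxq; rewrite !(adj_sym _ x) => /adj_vset-> /adj_vset->.
  - by rewrite /= Lx orbT.
  - by move=> z; rewrite !inE => /or3P[]/eqP->; rewrite /= ?eqxx ?neq ?inL.
  - move=> z; rewrite !inE => /or3P[]/eqP-> //; rewrite ?Lx // ?Ep ?Eq => _.
      by apply/subsetP=> u; rewrite !inE => /eqP->; rewrite eqxx orbT.
    by apply/subsetP=> u; rewrite !inE => /eqP->; rewrite eqxx orbT.
rewrite negb_exists in priv1; move/forallP: priv1 => priv1.
(* Second case: [r] has exactly the neighbours [x] and [y], with private neighbours [p] and [q]; the
   path is [p x r y q]. *)
have [/existsP[r /and3P[Nr /cards2P[x [y [xy Er]]] /forallP xyP]]|deg2] := boolP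
    [exists r, [&& r \in nbrs_of G L, #|nbrs G r| == 2
                 & [forall x, (x \in nbrs G r) ==> (priv G x != set0)]]].
  left; have [rx ry] : x \in nbrs G r /\ y \in nbrs G r.
    by rewrite Er !inE !eqxx orbT.
  have /set0Pn[p xp] := implyP (xyP x) rx.
  have /set0Pn[q yq] := implyP (xyP y) ry.
  have [Ep Eq] := (nbrs_priv xp, nbrs_priv yq).
  have [Gxp Gyq] : adj G x p /\ adj G y q.
    by move: xp yq; rewrite !inE => /andP[-> _] /andP[-> _].
  have [Gxr Gyr] : adj G x r /\ adj G y r.
    by move: rx ry; rewrite !inE !(adj_sym _ r) => -> ->.
  have L'r : r \notin L.
    by case/bigcupP: Nr => u Lu; rewrite inE => /adjL->; rewrite Lu.
  have [Lx Ly] : x \in L /\ y \in L.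
    by rewrite (adjL r x) 1?adj_sym // (adjL r y) 1?adj_sym // L'r.
  have [L'p L'q] : p \notin L /\ q \notin L.
    by rewrite (adjL _ _ Gxp) (adjL _ _ Gyq) Lx Ly.
  (* The sole neighbour of [p] is [x] and that of [q] is [y], while [r] sees both; hence [p], [r],
     [q] are pairwise distinct. *)
  have pr : p != r.
    by apply: contraNneq xy => pr; have := ry; rewrite -pr Ep inE eq_sym.
  have rq : r != q.
    by apply: contraNneq xy => rq; have := rx; rewrite rq Eq inE.
  have pq : p != q.
    apply: contraNneq xy => pq; have := Ep.
    by rewrite pq Eq => /set1_inj->.
  pose neq := (neqL x p Lx L'p, neqL x q Lx L'q, neqL x r Lx L'r,
               neqL y p Ly L'p, neqL y q Ly L'q, neqL y r Ly L'r,
               negPf pr, negPf rq, negPf pq, negPf xy).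
  pose inL := (Lx, Ly, negPf L'p, negPf L'q, negPf L'r).
  apply: (@matching24_cover_path G L R [:: p; x; r; y; q]) => //.
  - by rewrite /= !inE !neq.
  - by rewrite /= adj_sym Gxp Gxr adj_sym Gyr Gyq.
  - by move=> z; rewrite !inE => /or4P[|||/orP[]]/eqP->; apply/adj_vset;
      [rewrite adj_sym|..]; eauto; rewrite adj_sym; eauto.
  - by rewrite /= Lx orbT.
  - by move=> z; rewrite !inE => /or4P[|||/orP[]]/eqP->; rewrite /= ?eqxx ?neq ?inL.
  - move=> z; rewrite !inE => /or4P[|||/orP[]]/eqP->; rewrite ?Lx ?Ly // => _;
      rewrite ?Ep ?Eq ?Er; apply/subsetP=> u; rewrite !inE.
    + by move=> /eqP->; rewrite eqxx orbT.
    + by case/orP=> /eqP->; rewrite eqxx !orbT.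
    + by move=> /eqP->; rewrite eqxx !orbT.
right; apply: (@card_nbrs_of_le G L R) => //.
  by move=> x Lx; have := priv1 x; rewrite Lx -leqNgt.
move=> r Nr r2; rewrite negb_exists in deg2; move/forallP/(_ r): deg2.
rewrite Nr [#|_|]r2 eqxx /= negb_forall => /existsP[x].
by rewrite negb_imply negbK => /andP[rx /eqP x0]; exists x.
Qed.

End Graphs.

Local Open Scope ring_scope.

Theorem theorem2 (K : realType) (eps : K) (T : finType) (G : graph T)
    (L R : {set T}) :
  eps < 1 / 23%:R ->
  bipartition G L R ->
  (forall x, x \in L -> (degree G x <= 3)%N) ->
  (forall x y, x \in L -> y \in L -> x <> y ->
     degree G x = 3%N -> degree G y = 3%N -> nbrs G x <> nbrs G y) ->
  (2%:R - eps) * #|L|%:R <= #|nbrs_of G L|%:R ->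
  (forall L' : {set T}, L' \proper L ->
     exists F : graph T, matching24 G L F /\ covers F L') ->
  exists F : graph T, matching24 G L F /\ covers F L.
Proof.
move=> eps_lt bipG deg3 _ NL minL.
(* For empty [L] the empty graph is a matching; otherwise [#|L|] is positive, which makes the final
   inequality strict. *)
have [-> | L0] := eqVneq L set0.
  have Gempty : subgraph (path_graph [::]) G.
    by split=> [|x y /and3P[]//]; apply/subsetP=> x; rewrite inE.
  by exists (path_graph [::]); split; [split=> // x; rewrite !inE | apply: sub0set].
have [//|le59] := matching24_cover_or_card_le bipG deg3 minL.
have {L0} L0 : 0 < #|L|%:R :> K by rewrite ltr0n card_gt0.
move: le59; rewrite -(ler_nat K) !natrM => le59.
(* The bounds combine to [(1 - 5 * eps) * #|L| <= 0], impossible since [eps < 1/23 < 1/5] and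
   [#|L| > 0]. *)
nra.
Qed.
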